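(* For every max-min 1-bounded space 3-cardinality constrained algorithm $ALG$ and every positive integer $m$, there exists a sorted item sequence $I$ such that $OPT_3(I)=m$ and $ALG(I)\ge\frac43\cdot OPT_3(I)-\frac43$.
   Context: The $k$-cardinality constrained bin packing problem: an item sequence $I=(a_1,\dots,a_n)\in(0,1]^n$ must be packed into bins of capacity $1$ with at most $k$ items per bin; $OPT_k(I)$ is the minimum number of non-empty bins, $ALG(I)$ the number used by $ALG$. A $k$-cardinality constrained algorithm always outputs packings with at most $k$ items per bin. $I$ is sorted if $a_1\ge\cdots\ge a_n$. A max-min algorithm first sorts the input in non-increasing order and then repeatedly takes either the head (largest) or the tail (smallest) item of the currently remaining sorted sequence and packs it into a bin, each decision depending only on items already packed and the current head and tail items, without seeing other remaining items. A bin is open if it contains an item and may still receive items; closed bins never receive further items. A 1-bounded space algorithm keeps at most one open bin at any time. *)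

(* Defs.v *)
From mathcomp Require Import all_boot all_order all_algebra.
From mathcomp Require Import reals.
Set Implicit Arguments. Unset Strict Implicit. Unset Printing Implicit Defensive.
Import Order.TTheory GRing.Theory Num.Theory.
Local Open Scope ring_scope.

Section BinPacking.
Variable R : realType.

Definition items_ok (I : seq R) : bool := all (fun x => (0 < x) && (x <= 1)) I.

Definition sorted_items (I : seq R) : bool := sorted (fun x y => y <= x) I.

Definition bin_ok (k : nat) (b : seq R) : bool :=
  (\sum_(x <- b) x <= 1) && (size b <= k)%N.

Definition packing (k : nat) (I : seq R) (P : seq (seq R)) : Prop :=
  perm_eq (flatten P) I /\ all (fun b => (0 < size b)%N && bin_ok k b) P.

Definition opt_value (k : nat) (I : seq R) (m : nat) : Prop :=
  (exists P, packing k I P /\ size P = m) /\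
  (forall P, packing k I P -> (m <= size P)%N).

(** A max-min 1-bounded space algorithm.  At each step it sees the history of
    what has been packed (item size, whether it was the head (true) or the
    tail (false), whether it was placed in a freshly opened bin) and the
    current head and tail of the remaining sorted sequence, and returns
    (take_head, open_new_bin).  Opening a new bin closes the current open bin
    (so at most one bin is open at any time); closed bins never receive items.
    If there is no open bin yet, the item necessarily opens a new bin. *)
Definition maxmin_alg := seq (R * bool * bool) -> R -> R -> bool * bool.

(** Bins are kept in reverse order of opening; the head is the open bin. *)
Fixpoint run_aux (alg : maxmin_alg) (fuel : nat) (s : seq R)
    (hist : seq (R * bool * bool)) (bins : seq (seq R)) : seq (seq R) :=
  match fuel with
  | 0 => bins
  | f.+1 =>
    match s with
    | [::] => bins
    | h :: s1 =>
      let t := last h s1 in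
      let d := alg hist h t in
      let takeh := d.1 in
      let newb := d.2 in
      let x := if takeh then h else t in
      let s' := if takeh then s1 else belast h s1 in
      let bins' :=
        match bins with
        | b :: bs => if newb then [:: x] :: bins else (x :: b) :: bs
        | [::] => [:: [:: x]]
        end in
      run_aux alg f s' (rcons hist (x, takeh, newb)) bins'
    end
  end.

Definition alg_packing (alg : maxmin_alg) (I : seq R) : seq (seq R) :=
  let s := sort (fun x y => y <= x) I in run_aux alg (size s) s [::] [::].

Definition alg_cost (alg : maxmin_alg) (I : seq R) : nat :=
  size (alg_packing alg I).

Definition card_constrained (k : nat) (alg : maxmin_alg) : Prop :=
  forall I, items_ok I -> all (bin_ok k) (alg_packing alg I).

End BinPacking.

(* Main.v *)
Require Import Defs.
From mathcomp Require Import all_boot all_order all_algebra.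
From mathcomp Require Import reals.
From mathcomp Require Import lra zify.
Set Implicit Arguments. Unset Strict Implicit. Unset Printing Implicit Defensive.
Import Order.TTheory GRing.Theory Num.Theory.
Local Open Scope ring_scope.

(** The adversary presents tail items [1/8 - d/2], where [d] starts at [1/8] and
    is halved each time a tail item is taken, and every new head is [3/4 + d] for
    the [d] current when it becomes visible.  Such a head overflows with any two
    small items taken after that moment, so a bin of the algorithm containing a
    large item contains at most one small item.  It does fit, however, with one
    small item taken earlier together with any other item of size at most [1/8],
    so the optimum can combine each large item with two small ones: the first is
    an earlier item not used yet, the second is arbitrary.

    The instance has [m] large items (hence [OPT = m]).  If the algorithm closes
    about [m/3] bins without large item, all remaining items are large and each
    needs a further bin.  Otherwise, once [m - 1] large items are packed, items
    [1/8] are added until the optimum is full; the algorithm then has about [m]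
    small items outside its [m] bins with a large item, which cost it about
    [m/3] more bins. *)

(** * Runs of the algorithm from an intermediate state *)

Section Runs.
Variables (R : realType) (alg : maxmin_alg R).
Implicit Types (x h t : R) (b s q : seq R) (bins : seq (seq R)).

Definition place (newb : bool) x bins : seq (seq R) :=
  match bins with
  | b :: bs => if newb then [:: x] :: bins else (x :: b) :: bs
  | [::] => [:: [:: x]]
  end.

Lemma placeP newb x bins : exists b rest,
  place newb x bins = (x :: b) :: rest /\
  (b = [::] /\ rest = bins \/ bins = b :: rest).
Proof.
case: bins => [|b bs] /=; first by exists [::], [::]; split=> //; left.
by case: newb; [exists [::], (b :: bs); split=> //; left
               | exists b, bs; split=> //; right].
Qed.

Lemma perm_place newb x bins :
  perm_eq (flatten (place newb x bins)) (x :: flatten bins).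
Proof. by case: bins => [|b bs] //=; case: newb. Qed.

Lemma run_step n h s hist bins (d := alg hist h (last h s))
    (x := if d.1 then h else last h s) :
  run_aux alg n.+1 (h :: s) hist bins =
  run_aux alg n (if d.1 then s else belast h s)
    (rcons hist (x, d.1, d.2)) (place d.2 x bins).
Proof. by []. Qed.

(** Only the open bin can change, so the closed bins [behead bins] survive to the end. *)
Lemma run_suffix n s hist bins :
  exists pre, run_aux alg n s hist bins = pre ++ behead bins.
Proof.
elim: n s hist bins => [|n IHn] [|h s] hist bins.
1,2,3: by exists (take 1 bins); case: bins => //= b bs; rewrite take0.
rewrite run_step; set s' := if _ then s else _; set hist' := rcons _ _.
set x := if _ then h else _; set nb := snd _.
have [pre ->] := IHn s' hist' (place nb x bins).
have [b [rest [-> [[_ ->]|->]]]] := placeP nb x bins; last by exists pre.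
exists (pre ++ take 1 bins).
by rewrite -catA; case: (bins) => //= b' bs; rewrite take0.
Qed.

Lemma run_perm s hist bins :
  perm_eq (flatten (run_aux alg (size s) s hist bins)) (s ++ flatten bins).
Proof.
move sz: (size s) => n.
elim: n s sz hist bins => [|n IHn] [|h s] //= [sz] hist bins.
rewrite -/(place _ _ _); set d := alg _ _ _.
have step x s' hist' : size s' = n -> perm_eq (x :: s') (h :: s) ->
    perm_eq (flatten (run_aux alg n s' hist' (place d.2 x bins)))
            (h :: s ++ flatten bins).
  move=> sz' eq_s; apply: perm_trans (IHn _ sz' _ _) _.
  rewrite -cat_cons -(permPr (perm_cat eq_s (perm_refl _))) /=.
  by rewrite perm_sym -cat1s perm_catCA perm_cat2l perm_sym perm_place.
case: d.1; apply: step; rewrite ?size_belast //.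
by rewrite -perm_rcons -lastI.
Qed.

(** Items are nonnegative, so a bin that breaks a constraint stays illegal: a violation at any
    moment shows in the final packing. *)
Lemma run_ok k n s hist bins : all (fun x => 0 <= x) s ->
  all (bin_ok k) (run_aux alg n s hist bins) -> all (bin_ok k) bins.
Proof.
elim: n s hist bins => [|n IHn] [|h s] hist bins //= s_ge0.
rewrite -/(place _ _ _); set d := alg _ _ _; set x := if d.1 then h else _.
have mem_s : all (fun x => 0 <= x) (x :: if d.1 then s else belast h s).
  rewrite /x; case: d.1 => //.
  by have := s_ge0; rewrite -[_ && _]/(all _ (h :: s)) lastI all_rcons.
case/andP: mem_s => x_ge0 s'_ge0 /(IHn _ _ _ s'_ge0).
have [b [rest [-> [[_ ->]|->]]]] := placeP d.2 x bins => /= /andP[] //.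
rewrite /bin_ok big_cons /= => /andP[sumb szb] ->.
by rewrite (ltnW szb) !andbT (le_trans _ sumb) // lerDr.
Qed.

End Runs.

(** * Large items, their small companions, and optimal packings *)

Section Counting.
Variable R : realType.
Implicit Types (x h t : R) (b s u : seq R) (bins O P : seq (seq R)).

Definition big x := 1 / 2 < x.

Definition large_bin b := has big b.

Definition small_bins bins := count (predC large_bin) bins.

(** Small companions of large items, as a legal bin holds at most one large item. *)
Definition large_rest bins := \sum_(b <- bins | large_bin b) (size b).-1.

Lemma large_rest_cons b bins :
  large_rest (b :: bins) = (large_bin b * (size b).-1 + large_rest bins)%N.
Proof. by rewrite /large_rest big_cons; case: large_bin; rewrite ?mul1n. Qed.

Lemma large_rest_cat bins1 bins2 :
  large_rest (bins1 ++ bins2) = (large_rest bins1 + large_rest bins2)%N.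
Proof. exact: big_cat. Qed.

Lemma sum_ge0 b : all (fun x => 0 <= x) b -> 0 <= \sum_(x <- b) x.
Proof. by move=> /allP b0; rewrite big_seq; apply: sumr_ge0 => x /b0. Qed.

Lemma count_big_bin k b : all (fun x => 0 <= x) b -> bin_ok k b ->
  count big b = large_bin b.
Proof.
move=> b0 /andP[sb _]; rewrite /large_bin has_count.
suff: (count big b <= 1)%N by case: count => [|[]].
elim: b b0 sb => //= x b IHb /andP[x0 b0]; rewrite big_cons => sb.
have s0 := sum_ge0 b0.
case: (boolP (big x)) => [bx|_] /=; last by apply: IHb => //; lra.
suff: ~~ has big b by rewrite has_count -leqNgt leqn0 => /eqP ->.
apply/hasP => -[y yb by_].
have: y <= \sum_(x <- b) x.
  rewrite (big_rem y) //= lerDl sum_ge0 //.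
  by apply/allP => z /mem_rem /(allP b0).
by rewrite /big in bx by_; lra.
Qed.

Lemma count_big_bins k bins : all (fun x => 0 <= x) (flatten bins) ->
  all (bin_ok k) bins -> count big (flatten bins) = count large_bin bins.
Proof.
elim: bins => //= b bs IHbs.
rewrite all_cat count_cat => /andP[b0 bs0] /andP[okb okbs].
by rewrite (count_big_bin b0 okb) IHbs.
Qed.

Lemma size_flatten_bins k bins : all (bin_ok k) bins ->
  (size (flatten bins) <=
     large_rest bins + count large_bin bins + k * small_bins bins)%N.
Proof.
rewrite /small_bins; elim: bins => //= b bs IHbs.
move=> /andP[/andP[_ szb] /IHbs]; rewrite size_cat large_rest_cons.
by case: (large_bin b) => /=; lia.
Qed.

Lemma large_rest_le k bins : all (bin_ok k) bins ->
  (large_rest bins <= k.-1 * count large_bin bins)%N.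
Proof.
elim: bins => [|b bs IHbs] /=; first by rewrite /large_rest big_nil.
move=> /andP[/andP[_ szb] /IHbs]; rewrite large_rest_cons.
by case: (large_bin b) => /=; lia.
Qed.

Lemma large_rest_size bins :
  (large_rest bins + count large_bin bins <= size (flatten bins))%N.
Proof.
elim: bins => [|b bs IHbs]; first by rewrite /large_rest big_nil.
rewrite large_rest_cons /= size_cat.
have: (large_bin b <= size b)%N by case: b => // x b; case: large_bin.
by case: (large_bin b) => /=; lia.
Qed.

Lemma size_bins bins : size bins = (count large_bin bins + small_bins bins)%N.
Proof. by rewrite count_predC. Qed.

Lemma packing_perm k (I J : seq R) P :
  perm_eq I J -> packing k I P -> packing k J P.
Proof. by move=> eqIJ [eqP okP]; split=> //; apply: perm_trans eqIJ. Qed.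

(** Two items above 1/2 never share a bin, so every packing needs one bin per large item. *)
Lemma opt_value_big k (I : seq R) P : all (fun x => 0 <= x) I ->
  packing k I P -> size P = count big I -> opt_value k I (count big I).
Proof.
move=> I0 packP szP; split=> [|Q [eqQ okQ]]; first by exists P.
rewrite -(permP eqQ) (@count_big_bins k _) ?count_size //.
  by rewrite (perm_all _ eqQ).
by apply: sub_all okQ => b /andP[].
Qed.

(** The constants leave room for a third item of size at most 1/8. *)
Definition light b :=
  [&& (0 < size b)%N, (size b <= 2)%N & \sum_(x <- b) x <= 7 / 8].

Lemma packing_light O u : all light O -> all (fun x => x <= 1 / 8) u ->
  (size u <= size O)%N ->
  exists P, packing 3 (flatten O ++ u) P /\ size P = size O.
Proof.
elim: O u => [|b O IHO] u /=.
  by move=> _ _; rewrite leqn0 => /nilP ->; exists [::].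
case/andP=> /and3P[b0 b2 sb] lO u8 szu.
have [|||P [[eqP okP] szP]] := IHO (behead u) => //.
- by case: u u8 {szu} => //= x u /andP[].
- by rewrite size_behead; case: u szu {u8}.
exists ((take 1 u ++ b) :: P); rewrite /= szP; split=> //; split=> /=.
  apply/permP => p; have := permP eqP p.
  by rewrite -{3}(cat_take_drop 1 u) drop1 !count_cat => ->; lia.
rewrite okP andbT size_cat addn_gt0 b0 orbT /bin_ok big_cat size_cat /=.
apply/andP; split; last by case: (u) => [|x u'] /=; rewrite ?take0 /=; lia.
case: u u8 {szu eqP} => [|x u] /=; first by rewrite big_nil; lra.
by case/andP=> x8 _; rewrite take0 big_seq1; lra.
Qed.

End Counting.

Arguments big {R} x.
Arguments large_bin {R} b : simpl never.
Arguments light {R} b.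

Lemma sorted_items_nseq (R : realType) (h a t : R) k : a <= h -> t <= a ->
  sorted_items (h :: rcons (nseq k a) t).
Proof.
move=> ah ta; rewrite /sorted_items /=; elim: k h ah => [|k IHk] h ah /=.
  by rewrite andbT (le_trans ta).
by rewrite ah IHk.
Qed.

Lemma flatten_nseq1 (T : Type) (x : T) n : flatten (nseq n [:: x]) = nseq n x.
Proof. by elim: n => //= n ->. Qed.

(** * The invariant of the adversary *)

Section Adversary.
Variables (R : realType) (alg : maxmin_alg R) (m : nat).
Implicit Types (x h d t : R) (b s u q : seq R) (bins rest O P : seq (seq R)).

Definition tail_item d : R := 1 / 8 - d / 2.

(* A small item sharing the open bin with a large item, packed already or the
   visible head [h], leaves no room there for the tail item [1 / 8 - d / 2]. *)
Definition open_inv h d b :=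
  if large_bin b then
    size b = 1%N /\ 3 / 4 + d <= \sum_(x <- b) x \/
    size b = 2%N /\ 7 / 8 + d / 2 < \sum_(x <- b) x
  else [\/ b = [::], size b = 1%N /\ 7 / 8 + d / 2 < \sum_(x <- b) x + h
         | 1 < \sum_(x <- b) x + h].

(* [O] is a partial optimal packing with one bin per large item revealed so far
   (including the visible head [h]) and room in each bin for one more small item;
   [u] is the pool of small items already taken that are not placed in [O]. *)
Record adv_inv bins O u h d : Prop := AdvInv {
  inv_d : 0 < d;
  inv_h : 3 / 4 + d <= h <= 7 / 8;
  inv_ok : all (bin_ok 3) bins;
  inv_items : all (fun x => 0 < x <= 7 / 8) (flatten bins);
  inv_u : all (fun x => 0 < x <= 1 / 8 - d) u;
  inv_light : all light O;
  inv_perm : perm_eq (flatten O ++ u) (h :: flatten bins);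
  inv_big : (count big (flatten bins)).+1 = size O;
  inv_size : (size O <= m)%N;
  inv_pool : (size u + (size O == m) <= m)%N;
  inv_rest : (large_rest (behead bins) + large_bin (head [::] bins) + size O
                <= (size (flatten O)).+1)%N;
  inv_open : open_inv h d (head [::] bins) }.

(** The whole instance is [flatten bins ++ s]. Legality of the run is a premise because
    [card_constrained] speaks only of the packing of a complete input. *)
Definition forcing hist bins s :=
  [/\ sorted_items s, items_ok s &
      let run := run_aux alg (size s) s hist bins in
      all (bin_ok 3) run ->
      [/\ count big (flatten bins ++ s) = m,
          exists P, packing 3 (flatten bins ++ s) P /\ size P = m &
          (4 * m <= 3 * size run + 4)%N]].

Section State.
Variables (bins O : seq (seq R)) (u : seq R) (h d : R).
Hypothesis I : adv_inv bins O u h d.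

Lemma items_ge0 : all (fun x => 0 <= x) (flatten bins).
Proof. by apply: sub_all (inv_items I) => x /andP[/ltW]. Qed.

Lemma big_h : big h.
Proof. by have := inv_d I; have /andP[h1 h2] := inv_h I; rewrite /big; lra. Qed.

Lemma count_large : (count large_bin bins).+1 = size O.
Proof. by rewrite -(inv_big I) (count_big_bins items_ge0 (inv_ok I)). Qed.

Lemma size_items : (size (flatten O) + size u = (size (flatten bins)).+1)%N.
Proof. by rewrite -size_cat (perm_size (inv_perm I)). Qed.

Lemma head_rest :
  (large_rest bins <= large_rest (behead bins) + large_bin (head [::] bins))%N.
Proof.
have := inv_open I; case: bins => [|b bs] /=; first by rewrite addn0.
rewrite large_rest_cons /open_inv.
by case: (large_bin b) => /= [[] [-> _]|_]; lia.
Qed.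

(** By [inv_rest], [O] contains, up to one, as many small items as the closed large bins do. The
    pool is thus bounded by three items per closed small bin, three in the open bin, and this
    one. *)
Lemma pool_bound : (size u <= 3 * small_bins (behead bins) + 4)%N.
Proof.
have := inv_rest I; have := size_items; have := count_large.
have := inv_open I; have := inv_ok I.
case: bins => [|b bs] /=; first by lia.
move=> /andP[/andP[_ b3] okbs] opn; have := size_flatten_bins okbs.
rewrite size_cat; move: opn; rewrite /open_inv.
by case: (large_bin b) => /=; [case=> -[-> _]|]; lia.
Qed.

(** * Each decision of the algorithm keeps the invariant *)

Lemma tail_gt0 : 0 < tail_item d < 1 / 8.
Proof.
by have := inv_d I; have /andP[h1 h2] := inv_h I; rewrite /tail_item; lra.
Qed.

Lemma inv_tail newb (t := tail_item d) :
  (size O < m)%N -> (3 * small_bins (behead bins) + 4 < m)%N ->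
  all (bin_ok 3) (place newb t bins) ->
  adv_inv (place newb t bins) O (t :: u) h (d / 2).
Proof.
move=> ltOm lt_m ok'; have d0 := inv_d I; have /andP[h1 h2] := inv_h I.
have /andP[t0 t8] := tail_gt0; have pu := pool_bound.
have hr := head_rest; have hrest := inv_rest I.
have nbt : big t = false by apply/negbTE; rewrite /big -leNgt /t; lra.
have [b [rest [E hb]]] := placeP newb t bins.
have pp := perm_place newb t bins.
have lb' : large_bin (t :: b) = large_bin b by rewrite /large_bin /= nbt.
split=> //.
- by lra.
- by lra.
- rewrite (perm_all _ pp) /= (inv_items I) andbT /t; lra.
- rewrite /= {1 2}/t /tail_item; apply/andP; split; first by lra.
  by apply: sub_all (inv_u I) => x; lra.
- exact: inv_light I.
- rewrite -cat1s perm_catCA /= perm_sym -cat1s.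
  rewrite (perm_trans (perm_cat (perm_refl [:: h]) pp)) //.
  rewrite -[_ :: flatten _]cat1s perm_catCA /= perm_cons perm_sym.
  exact: inv_perm I.
- by rewrite (permP pp) /= nbt (inv_big I).
- exact: inv_size I.
(* [pool_bound] and the hypothesis on [small_bins] leave a place for [t] in the pool. *)
- by rewrite /= (ltn_eqF ltOm); lia.
- rewrite E /= lb'.
  case: hb => [[-> ->]|Eb]; last by move: hrest; rewrite Eb.
  by rewrite [large_bin [::]]/large_bin /=; lia.
have t_bin b' : \sum_(x <- t :: b') x = t + \sum_(x <- b') x.
  by rewrite big_cons.
move: ok'; rewrite E => /= /andP[/andP[]]; rewrite t_bin => sb' sz' _.
rewrite /open_inv lb' t_bin /=.
have tE : t = 1 / 8 - d / 2 by [].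
case: hb => [[-> _]|Eb].
  by rewrite big_nil /=; constructor 2; split=> //; lra.
(* [t] added to anything above [7 / 8 + d / 2] exceeds 1: it cannot join a large item with a
   companion, and two small items leave no room for the head. *)
move: (inv_open I); rewrite Eb /= /open_inv; case: (large_bin b).
  by case=> -[-> sb]; [right; split=> //; lra|lra].
case=> [->|[-> sb]|sb]; last by constructor 3; lra.
  by rewrite big_nil /=; constructor 2; split=> //; lra.
by constructor 3; lra.
Qed.

Lemma inv_head newb :
  (size O < m)%N -> (3 * small_bins (behead bins) + 4 < m)%N ->
  all (bin_ok 3) (place newb h bins) ->
  exists O' u', adv_inv (place newb h bins) O' u' (3 / 4 + d) d.
Proof.
move=> ltOm lt_m ok'; have d0 := inv_d I; have /andP[h1 h2] := inv_h I.
have pu := pool_bound; have hr := head_rest; have bh := big_h.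
have hrest := inv_rest I; have cl := count_large.
have [b [rest [E hb]]] := placeP newb h bins.
have pp := perm_place newb h bins.
have i0 : all (fun x => 0 <= x) (flatten (place newb h bins)).
  by rewrite (perm_all _ pp) /= items_ge0; lra.
have nlb : bins = b :: rest -> large_bin b = false.
  move=> _; move: i0 ok'; rewrite E /= all_cat => /and3P[h0 b0 _] /andP[okb _].
  have hb0 : all (fun x => 0 <= x) (h :: b) by rewrite /= h0.
  have := count_big_bin hb0 okb; rewrite /large_bin /= bh /= has_count.
  by case: count.
have rest_le : (large_rest rest <= large_rest bins)%N.
  by case: hb => [[_ ->]|->] //; rewrite large_rest_cons leq_addl.
(* The new head and a pool item, at most [1 / 8 - d], together stay within 7/8, so their bin is
   light. *)
pose O' := if u is x :: _ then [:: 3 / 4 + d; x] :: O else [:: 3 / 4 + d] :: O.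
have szO' : size O' = (size O).+1 by rewrite /O'; case: (u).
exists O', (behead u); split=> //.
- by rewrite lexx; lra.
- by rewrite (perm_all _ pp) /= (inv_items I) andbT; lra.
- by move: (inv_u I); case: (u) => //= x u' /andP[].
- rewrite /O'; move: (inv_u I) (inv_light I); case: (u) => [|x u'] /=.
    by move=> _ ->; rewrite /light /= big_seq1 andbT; lra.
  case/andP=> x8 _ ->; rewrite /light /= big_cons big_seq1 andbT; lra.
- have -> : flatten O' ++ behead u = 3 / 4 + d ::
      (if u is x :: u' then x :: flatten O ++ u' else flatten O ++ u).
    by rewrite /O'; case: (u).
  rewrite perm_cons (permPr pp) -(permPr (inv_perm I)); case: (u) => // x u'.
  by rewrite -[x :: u']cat1s perm_sym perm_catCA.
- by rewrite (permP pp) /= bh szO' -(inv_big I).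
- by rewrite szO'.
- rewrite szO' size_behead; have := inv_pool I; case: eqP; case: eqP; lia.
(* With a pool item the left side grows by at most two and the right side by two; with an empty pool
   [O] holds every small item, and the slack of one closes the count. *)
- rewrite E szO' /= {1}/large_bin /= bh.
  have := large_rest_size bins; have := size_items.
  rewrite /O'; case: (u) => [|x u'] /=; lia.
have h_bin b' : \sum_(x <- h :: b') x = h + \sum_(x <- b') x.
  by rewrite big_cons.
move: ok'; rewrite E => /= /andP[/andP[]]; rewrite h_bin => sb' sz' _.
rewrite /open_inv {1}/large_bin /= bh /= h_bin.
case: hb => [[-> _]|Eb]; first by rewrite big_nil /=; left; split=> //; lra.
move: (inv_open I); rewrite Eb /= /open_inv nlb // => -[->|[-> sb]|sb].
- by rewrite big_nil /=; left; split=> //; lra.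
- by right; split=> //; lra.
by lra.
Qed.

Lemma count_large_run hist s (run := run_aux alg (size s) s hist bins) :
  items_ok s -> all (bin_ok 3) run ->
  count large_bin run = (count big s + count big (flatten bins))%N.
Proof.
move=> s_ok run_ok; have p := run_perm alg s hist bins.
rewrite -count_cat -(permP p) (count_big_bins _ run_ok) //.
rewrite (perm_all _ p) all_cat items_ge0 andbT.
by apply: sub_all s_ok => x /andP[/ltW].
Qed.

Lemma small_bins_run n s hist :
  (small_bins (behead bins) <= small_bins (run_aux alg n s hist bins))%N.
Proof.
have [pre ->] := run_suffix alg n s hist bins.
by rewrite /small_bins count_cat leq_addl.
Qed.

(** Large bins of [run] outside [behead bins] have at most two companions each; companions in closed
    bins are bounded by [inv_rest]. *)
Lemma size_run hist s (run := run_aux alg (size s) s hist bins) :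
  all (bin_ok 3) run ->
  (size s + size (flatten bins) + size O + 2 * count large_bin bins <=
     size (flatten O) + 3 * count large_bin run + 3 * small_bins run + 2)%N.
Proof.
move=> run_ok; have [pre E] := run_suffix alg (size s) s hist bins.
have size_flat : size (flatten run) = (size s + size (flatten bins))%N.
  by rewrite (perm_size (run_perm alg s hist bins)) size_cat.
rewrite -size_flat; have := size_flatten_bins run_ok; have := inv_rest I.
move: run_ok; rewrite /run E all_cat => /andP[/large_rest_le /= pre_ok _].
rewrite large_rest_cat count_cat.
have : (count large_bin bins =
  large_bin (head [::] bins) + count large_bin (behead bins))%N by case: bins.
by have := leq_b1 (large_bin (head [::] bins)); lia.
Qed.

(** * The two ways to complete the instance *)

(** All remaining items but [t] are large. The closed small bins, at least [(m - 4) / 3] of them,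
    come on top of [m] bins with large items. *)
Lemma forcing_small_bins hist : (size O < m)%N ->
  (m <= 3 * small_bins (behead bins) + 4)%N ->
  exists q, forcing hist bins (h :: rcons q (tail_item d)).
Proof.
move=> ltOm le_m; have d0 := inv_d I; have /andP[h1 h2] := inv_h I.
have /andP[t0 t8] := tail_gt0; set t := tail_item d in t0 t8 *.
have nbt : big t = false by apply/negbTE; rewrite /big -leNgt; lra.
exists (nseq (m - size O) (3 / 4)); set s := _ :: _.
have s_ok : items_ok s.
  rewrite /items_ok /= all_rcons all_nseq; apply/and3P; split; last first.
  - by apply/orP; right; lra.
  - by lra.
  - by lra.
have cs : count big s = (m - size O).+1.
  rewrite /= big_h -cats1 count_cat count_nseq /= nbt /big.
  have -> : 1 / 2 < 3 / 4 :> R by lra.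
  by rewrite /=; lia.
have cb : (count big (flatten bins)).+1 = size O := inv_big I.
split=> //; first by apply: sorted_items_nseq; lra.
move=> run run_ok; split.
- by rewrite count_cat cs; lia.
(* Every large item not yet in [O] gets a light bin, one of them shared with [t]; the pool is then
   spread over all bins. *)
- pose O' := [:: 3 / 4; t] :: nseq (m - size O).-1 [:: 3 / 4] ++ O.
  have [|||P [packP szP]] := @packing_light R O' u.
    + rewrite /= all_cat (inv_light I) andbT all_nseq /light /=.
      rewrite !big_cons !big_nil.
      by apply/andP; split; [lra | apply/orP; right; lra].
    + by apply: sub_all (inv_u I) => x; lra.
    + by have := inv_pool I; rewrite /= size_cat size_nseq; lia.
  exists P; split; last by rewrite szP /= size_cat size_nseq; lia.
  apply: packing_perm packP; apply/permP => p.
  have := permP (inv_perm I) p.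
  rewrite /s /= flatten_cat flatten_nseq1 /= -cats1 !count_cat /=.
  by rewrite !count_cat !count_nseq /=; nia.
have := count_large_run s_ok run_ok; have := small_bins_run (size s) s hist.
by rewrite size_bins -/run cs; lia.
Qed.

(** In the end [m] small items lie outside [O], while the small items in large bins exceed those in
    [O] by a constant only; the others need small bins, at most three per bin. *)
Lemma forcing_large_bins hist : size O = m ->
  exists q, forcing hist bins (h :: rcons q (tail_item d)).
Proof.
move=> eqOm; have d0 := inv_d I; have /andP[h1 h2] := inv_h I.
have /andP[t0 t8] := tail_gt0; set t := tail_item d in t0 t8 *.
have nbt : big t = false by apply/negbTE; rewrite /big -leNgt; lra.
have ltum : (size u < m)%N by have := inv_pool I; rewrite eqOm eqxx; lia.
(* With [u] and [t] these are [m] items of size at most 1/8, one for each light bin of [O]. *)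
exists (nseq (m - (size u).+1) (1 / 8)); set s := _ :: _.
have s_ok : items_ok s.
  rewrite /items_ok /= all_rcons all_nseq; apply/and3P; split; last first.
  - by apply/orP; right; lra.
  - by lra.
  - by lra.
have cs : count big s = 1%N.
  rewrite /= big_h -cats1 count_cat count_nseq /= nbt /big.
  by have /lt_gtF -> : 1 / 8 < 1 / 2 :> R by lra.
have cb : (count big (flatten bins)).+1 = size O := inv_big I.
split=> //; first by apply: sorted_items_nseq; lra.
move=> run run_ok; split.
- by rewrite count_cat cs; lia.
- have [|||P [packP szP]] := @packing_light R O (u ++ behead s).
    + exact: inv_light I.
    + rewrite all_cat all_rcons all_nseq lexx orbT andbT.
      by apply/andP; split; [apply: sub_all (inv_u I) => x; lra | lra].
    + by rewrite size_cat /= size_rcons size_nseq; lia.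
  exists P; split; last by rewrite szP.
  apply: packing_perm packP; apply/permP => p.
  have := permP (inv_perm I) p; rewrite /s /= !count_cat /=; lia.
have := count_large_run s_ok run_ok; have := size_run run_ok.
have := size_items; have := count_large.
have szs : size s = (m - size u).+1 by rewrite /= size_rcons size_nseq; lia.
by rewrite -!/run szs (size_bins run) cs; lia.
Qed.

End State.

(** * Building the input along the decisions *)

(** The decision sees only [hist], [h] and [t], so the middle [q] may be fixed after it. *)
Lemma forcing_step hist bins h t q s' (d := alg hist h t)
    (hist' := rcons hist ((if d.1 then h else t), d.1, d.2))
    (bins' := place d.2 (if d.1 then h else t) bins) :
  s' = (if d.1 then rcons q t else h :: q) ->
  sorted_items (h :: rcons q t) -> items_ok (h :: rcons q t) ->
  forcing hist' bins' s' -> forcing hist bins (h :: rcons q t).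
Proof.
move=> E sorted_s ok_s [_ _ F]; split=> //=.
rewrite -/(place _ _ _) last_rcons belast_rcons -/d -/bins' -/hist'.
have -> : (if d.1 then rcons q t else h :: q) = s' by [].
have -> : size (rcons q t) = size s'.
  by rewrite E; case: d.1; rewrite // size_rcons.
have p : perm_eq (flatten bins' ++ s') (flatten bins ++ h :: rcons q t).
  apply/permP => a.
  have := permP (perm_place d.2 (if d.1 then h else t) bins) a.
  rewrite E -/bins' /= !count_cat => -> /=; rewrite -cats1.
  by case: d.1; rewrite /= !count_cat /=; lia.
move=> run_ok; have [cm [P [packP szP]] le_m] := F run_ok.
split=> //; first by rewrite -(permP p).
by exists P; split=> //; apply: packing_perm packP.
Qed.

(** Induction on the fuel [n]. [O] has at most two items in each of at most [m] bins and the pool at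
    most [m] items, so fewer than [3 * m] items are packed and the fuel cannot run out. *)
Lemma adversary n hist bins O u h d : adv_inv bins O u h d ->
  (3 * m <= n + size (flatten bins))%N ->
  exists q, forcing hist bins (h :: rcons q (tail_item d)).
Proof.
elim: n hist bins O u h d => [|n IHn] hist bins O u h d I.
  have := size_items I; have := inv_pool I; have := inv_size I.
  have : (size (flatten O) <= 2 * size O)%N.
    elim: (O) (inv_light I) => //= b O' IHO /andP[/and3P[_ b2 _] /IHO].
    by rewrite size_cat; lia.
  by lia.
move=> lt_n; have [eqOm|ltOm] := leqP m (size O).
  by apply: (forcing_large_bins I); have := inv_size I; lia.
have [le_m|lt_m] := leqP m (3 * small_bins (behead bins) + 4).
  exact: (forcing_small_bins I).
have d0 := inv_d I; have /andP[h1 h2] := inv_h I.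
have /andP[t0 t8] := tail_gt0 I; set t := tail_item d in t0 t8 *.
pose dec := alg hist h t; pose x := if dec.1 then h else t.
pose bins' := place dec.2 x bins; pose hist' := rcons hist (x, dec.1, dec.2).
have szb : size (flatten bins') = (size (flatten bins)).+1.
  exact: perm_size (perm_place _ _ _).
have [ok'|nok'] := boolP (all (bin_ok 3) bins'); last first.
  (* After a violation any continuation will do: the premise of [forcing] fails. *)
  exists [::].
  apply: (forcing_step (s' := if dec.1 then [:: t] else [:: h])) => //.
  - by apply: (@sorted_items_nseq _ h h t 0); lra.
  - by rewrite /items_ok /= !andbT; lra.
  split.
  - by case: dec.1.
  - by rewrite /items_ok; case: dec.1 => /=; lra.
  move=> run ok; case/negP: nok'; apply: run_ok ok.
  by case: dec.1 => /=; lra.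
have xE : x = if dec.1 then h else t by [].
case: {2 3}dec.1 (erefl dec.1) xE => dE xE.
  have [O' [u' I']] : exists O' u', adv_inv bins' O' u' (3 / 4 + d) d.
    by move: ok'; rewrite /bins' xE; apply: (inv_head I).
  have [|q F] := IHn hist' _ _ _ _ _ I'; first by lia.
  exists (3 / 4 + d :: q); apply: forcing_step (F) => //.
  - by rewrite -/dec dE.
  - by case: F; rewrite /sorted_items /= => -> _ _; rewrite andbT; lra.
  - by case: F => _; rewrite /items_ok /= => -> _; rewrite andbT; lra.
have I' : adv_inv bins' O (t :: u) h (d / 2).
  by move: ok'; rewrite /bins' xE; apply: (inv_tail I).
have [|q F] := IHn hist' _ _ _ _ _ I'; first by lia.
exists (rcons q (tail_item (d / 2))); apply: forcing_step (F) => //.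
- by rewrite -/dec dE.
- case: F; rewrite /sorted_items /= => + _ _.
  by rewrite !rcons_path last_rcons => ->; rewrite /t /tail_item; lra.
- case: F => _ ok_q _.
  by rewrite /items_ok -rcons_cons all_rcons [all _ _]ok_q andbT; lra.
Qed.

End Adversary.

(** * Initial state and conclusion *)

Theorem theorem9 (R : realType) (alg : maxmin_alg R) (m : nat) :
  card_constrained 3 alg -> (0 < m)%N ->
  exists I : seq R,
    [/\ items_ok I, sorted_items I, opt_value 3 I m &
        (4 / 3 : R) * m%:R - 4 / 3 <= (alg_cost alg I)%:R].
Proof.
move=> alg_ok m_gt0.
have I : adv_inv m [::] [:: [:: 7 / 8]] [::] (7 / 8) (1 / 8 : R).
  split=> //=; try lra.
  - by rewrite /light /= big_seq1 andbT lexx.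
  - by case: eqP.
  - by rewrite /large_rest big_nil.
  by constructor 1.
have [|q [sorted_s ok_s F]] := @adversary R alg m (3 * m) [::] _ _ _ _ _ I.
  by rewrite addn0.
exists (7 / 8 :: rcons q (tail_item (1 / 8))).
set s := _ :: _ in sorted_s ok_s F *.
have run_s : alg_packing alg s = run_aux alg (size s) s [::] [::].
  rewrite /alg_packing; have -> // : sort (fun x y : R => y <= x) s = s.
  by apply: sorted_sort => // x y z xy yz; apply: le_trans xy.
have [|big_s [P [packP szP]] cost] := F; first by rewrite -run_s; apply: alg_ok.
split=> //.
  rewrite -{1}big_s; apply: opt_value_big packP _; last by rewrite szP big_s.
  by apply: sub_all ok_s => x /andP[/ltW].
rewrite /alg_cost run_s; move: cost; rewrite -(ler_nat R) natrD !natrM; lra.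
Qed.
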